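(* Let $\Gamma$ be a strongly regular graph with parameters $(v,k,\lambda,\mu)$ having smallest eigenvalue $-m$. Assume that $k\geqslant m^2(4m-5)$ and that $\Gamma$ contains a Delsarte clique, i.e. a clique of order exactly $1+\frac{k}{m}$. Then either $$\mu \leqslant \frac{k+m^2 - \sqrt{(k+m^2)(k-4m^3+5m^2)}}{2}\quad\text{or}\quad \mu \geqslant \frac{k+m^2 + \sqrt{(k+m^2)(k-4m^3+5m^2)}}{2}.$$
   Context: All graphs are finite, undirected and simple. A regular graph with $v$ vertices and valency $k$ is edge-regular with parameters $(v,k,\lambda)$ if any two adjacent vertices have exactly $\lambda$ common neighbors. An edge-regular graph with parameters $(v,k,\lambda)$ is amply regular with parameters $(v,k,\lambda,\mu)$ if any two vertices at distance $2$ have exactly $\mu$ common neighbors. A strongly regular graph with parameters $(v,k,\lambda,\mu)$ is an amply regular graph with parameters $(v,k,\lambda,\mu)$ with diameter at most $2$. Eigenvalues of a graph are the eigenvalues of its adjacency matrix. A clique is a set of pairwise adjacent vertices, and its order is its number of vertices. In a strongly regular graph with valency $k$ and smallest eigenvalue $-m$, every clique has order at most $1+\frac{k}{m}$ (the Delsarte bound); a clique attaining equality is called a Delsarte clique.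
   Formalization: The graph is additionally assumed not to be complete: a complete graph has no vertices at distance 2, so every μ is admissible for it and the claim fails (e.g. K_3 with k=2, m=1, μ=1). *)

(* Defs.v *)
From HB Require Import structures.
From mathcomp Require Import all_boot all_order all_algebra.
Set Implicit Arguments.
Unset Strict Implicit.
Unset Printing Implicit Defensive.
Import Order.TTheory GRing.Theory Num.Theory.
Local Open Scope ring_scope.

Definition simple_graph (T : finType) (e : rel T) : Prop :=
  symmetric e /\ irreflexive e.

Definition neighbors (T : finType) (e : rel T) (x : T) : {set T} :=
  [set y | e x y].

Definition walk (T : finType) (e : rel T) (n : nat) (x y : T) : Prop :=
  exists p : seq T, [/\ path e x p, last x p = y & size p = n].

Definition at_distance (T : finType) (e : rel T) (n : nat) (x y : T) : Prop :=
  walk e n x y /\ forall j : nat, (j < n)%N -> ~ walk e j x y.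

(* A disconnected graph has infinite diameter, so this entails connectedness. *)
Definition diameter_at_most (T : finType) (e : rel T) (d : nat) : Prop :=
  forall x y : T, exists2 n : nat, (n <= d)%N & at_distance e n x y.

Definition regular (T : finType) (e : rel T) (v k : nat) : Prop :=
  [/\ simple_graph e, #|T| = v & forall x : T, #|neighbors e x| = k].

Definition edge_regular (T : finType) (e : rel T) (v k lambda : nat) : Prop :=
  regular e v k /\
  forall x y : T, e x y -> #|neighbors e x :&: neighbors e y| = lambda.

Definition amply_regular (T : finType) (e : rel T) (v k lambda mu : nat) :
    Prop :=
  edge_regular e v k lambda /\
  forall x y : T, at_distance e 2 x y ->
    #|neighbors e x :&: neighbors e y| = mu.

(* For a complete graph no two vertices are at distance 2, so every mu is
   admissible here. *)
Definition strongly_regular (T : finType) (e : rel T) (v k lambda mu : nat) :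
    Prop :=
  amply_regular e v k lambda mu /\ diameter_at_most e 2.

Definition complete_graph (T : finType) (e : rel T) : Prop :=
  forall x y : T, x != y -> e x y.

Definition adjacency_matrix (R : nzRingType) (T : finType) (e : rel T) :
    'M[R]_#|T| :=
  \matrix_(i, j) (e (enum_val i) (enum_val j))%:R.

Definition smallest_eigenvalue (R : realFieldType) (T : finType) (e : rel T)
    (a : R) : Prop :=
  eigenvalue (adjacency_matrix R e) a /\
  forall b : R, eigenvalue (adjacency_matrix R e) b -> a <= b.

Definition clique (T : finType) (e : rel T) (C : {set T}) : Prop :=
  {in C &, forall x y : T, x != y -> e x y}.

(* k is the valency and - m the smallest eigenvalue of the graph. *)
Definition delsarte_clique (R : realFieldType) (T : finType) (e : rel T)
    (k : nat) (m : R) (C : {set T}) : Prop :=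
  clique e C /\ #|C|%:R = 1 + k%:R / m.

(* Main.v *)
Require Import Defs.
From HB Require Import structures.
From mathcomp Require Import all_boot all_order all_algebra.
From mathcomp Require Import ring lra.
Set Implicit Arguments.
Unset Strict Implicit.
Unset Printing Implicit Defensive.
Import Order.TTheory GRing.Theory Num.Theory.
Local Open Scope ring_scope.

(* Let A be the adjacency matrix, J the all-ones matrix and r the eigenvalue
   other than k and -m.  Up to the factor r + m, the matrix
   E = A + m I - ((k + m) / v) J is the orthogonal projection onto the
   r-eigenspace, so (r + m) rank E = tr E = v m - k - m.  The restriction of E
   to a clique C is (m - 1) I plus a multiple of J, and m > 1, so
   rank E >= |C| - 1.
   For a Delsarte clique |C| - 1 = k / m, and eliminating v and r gives
   mu (k + m^2 - mu) <= m^2 (m - 1) (k + m) <= m^2 (m - 1) (k + m^2),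
   which says that mu does not lie strictly between the roots of
   x^2 - (k + m^2) x + m^2 (m - 1) (k + m^2). *)

(** * Trace and rank of matrices *)

Lemma mxtrace_quasi_idempotent (F : fieldType) n (E : 'M[F]_n) (a : F) :
  E *m E = a *: E -> \tr E = a * (\rank E)%:R.
Proof.
move=> EE.
(* In the full-rank factorization of [E], [col_base E] has a left inverse and [row_base E] a right
   inverse. Cancelling both in [E *m E = a *: E] leaves the reversed product equal to the scalar [a]
   in size [\rank E]. *)
have/row_freeP[B' BB'] := row_base_free E.
have/row_fullP[C' C'C] := col_base_full E.
have defBC : row_base E *m col_base E = a%:M.
  move: (col_base E) (row_base E) C' B' C'C BB' (mulmx_base E).
  move: (\rank E) => r C B C' B' C'C BB' defE.
  have: C' *m (E *m E) *m B' = C' *m (a *: E) *m B' by rewrite EE.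
  rewrite -scalemxAr -scalemxAl -defE !mulmxA C'C !mul1mx.
  by rewrite -!mulmxA BB' !mulmx1 scalemx1.
by rewrite -{1}(mulmx_base E) mxtrace_mulC defBC mxtrace_scalar mulr_natr.
Qed.

Lemma mxrank_mxsub (F : fieldType) m n m' n' (f : 'I_m' -> 'I_m)
    (g : 'I_n' -> 'I_n) (A : 'M[F]_(m, n)) :
  (\rank (mxsub f g A) <= \rank A)%N.
Proof.
rewrite -[A in mxsub _ _ A]mulmx1 mxsub_mul.
by rewrite (leq_trans (mxrankM_maxl _ _)) // rowsubE mxrankM_maxr.
Qed.

(** Subtracting the constant matrix, of rank at most 1, leaves an invertible scalar matrix. *)
Lemma mxrank_scalar_add_const (F : fieldType) n (a b : F) :
  a != 0 -> (n <= (\rank (a%:M + const_mx b : 'M[F]_n)%R).+1)%N.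
Proof.
move=> a_neq0.
have rank_const c : (\rank (const_mx c : 'M[F]_n) <= 1)%N.
  suff -> : const_mx c = (const_mx c : 'cV_n) *m (const_mx 1 : 'rV_n).
    exact: mulmx_max_rank.
  by apply/matrixP=> i j; rewrite !mxE big_ord1 !mxE mulr1.
have rank_a : \rank (a%:M : 'M[F]_n) = n.
  by rewrite -scalemx1 mxrank_scale_nz // mxrank1.
have := mxrank_add (a%:M + const_mx b : 'M[F]_n) (const_mx (- b)).
have -> : a%:M + const_mx b + const_mx (- b) = a%:M :> 'M[F]_n.
  by apply/matrixP=> i j; rewrite !mxE addrK.
by rewrite rank_a => /leq_trans-> //; rewrite -addn1 leq_add2l rank_const.
Qed.

(** * Inequalities between the parameters *)

Section StronglyRegular.

Variables (T : finType) (e : rel T) (v k lambda mu : nat).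
Hypothesis srg_e : strongly_regular e v k lambda mu.
Hypothesis ncomplete_e : ~ complete_graph e.

Let e_sym : symmetric e. Proof. by case: srg_e => [[[[[]]]]]. Qed.
Let e_irr : irreflexive e. Proof. by case: srg_e => [[[[[]]]]]. Qed.
Let cardT : #|T| = v. Proof. by case: srg_e => [[[[]]]]. Qed.
Let deg x : #|neighbors e x| = k. Proof. by case: srg_e => [[[[]]]]. Qed.
Let common_adj x y : e x y -> #|neighbors e x :&: neighbors e y| = lambda.
Proof. by case: srg_e => [[[_ +] _] _]; apply. Qed.

Lemma nonadjacent_at_distance2 x y : x != y -> ~~ e x y -> at_distance e 2 x y.
Proof.
move=> neq_xy nexy; case: srg_e => _ /(_ x y)[[|[|[|//]]] _] //.
- case=> -[p [_ + /size0nil p0]] _; rewrite p0 /= => eqxy.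
  by rewrite eqxy eqxx in neq_xy.
- case=> -[p [+ + +]] _; case: p => [|z [|? ?]] //=.
  by rewrite andbT => exz eqzy; rewrite -eqzy exz in nexy.
Qed.

Let common_nadj x y :
  x != y -> ~~ e x y -> #|neighbors e x :&: neighbors e y| = mu.
Proof.
move=> neq_xy nexy; case: srg_e => [[_ + _]]; apply.
exact: nonadjacent_at_distance2.
Qed.

Lemma exists_induced_path2 : exists x y z, [/\ e x y, e y z, x != z & ~~ e x z].
Proof.
case: (pickP [pred p : T * T | (p.1 != p.2) && ~~ e p.1 p.2]) => [[x z]|cpl].
  case/andP=> /= neq_xz nexz.
  have [[p []]] := nonadjacent_at_distance2 neq_xz nexz.
  case: p => [|y [|z' [|? ?]]] //= /and3P[exy eyz' _] eqz _ _.
  by exists x, y, z; split=> //; rewrite -eqz.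
case: ncomplete_e => x y neq_xy; apply/negPn/negP=> nexy.
by have /= := cpl (x, y); rewrite /= neq_xy nexy.
Qed.

Lemma srg_mu_gt0 : (0 < mu)%N.
Proof.
have [x [y [z [exy eyz neq_xz nexz]]]] := exists_induced_path2.
rewrite -(common_nadj neq_xz nexz); apply/card_gt0P; exists y.
by rewrite !inE exy e_sym.
Qed.

Lemma srg_mu_le_valency : (mu <= k)%N.
Proof.
have [x [y [z [_ _ neq_xz nexz]]]] := exists_induced_path2.
by rewrite -(common_nadj neq_xz nexz) -(deg x) subset_leq_card ?subsetIl.
Qed.

(** On an induced path x, y, z, the common neighbors of x and y are neighbors of y other than x and
    z. *)
Lemma srg_lambda_lt : (lambda.+2 <= k)%N.
Proof.
have [x [y [z [exy eyz neq_xz nexz]]]] := exists_induced_path2.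
rewrite -(common_adj exy) -(deg y) (cardsD1 x (neighbors e y)).
rewrite (cardsD1 z (neighbors e y :\ x)) !inE e_sym exy eyz eq_sym neq_xz /=.
rewrite !add1n !ltnS subset_leq_card //; apply/subsetP=> t; rewrite !inE.
case/andP=> ext eyt; rewrite eyt andbT; apply/andP; split.
  by apply: contraNneq nexz => <-.
by apply: contraTneq ext => ->; rewrite e_irr.
Qed.

(** * The matrices A and J, and the eigenvalues of A *)

Variable R : rcfType.
Let A : 'M[R]_#|T| := adjacency_matrix R e.
Let J : 'M[R]_#|T| := const_mx 1.

Lemma adjacency_sqr :
  A *m A = (k%:R - mu%:R)%:M + (lambda%:R - mu%:R) *: A + mu%:R *: J.
Proof.
apply/matrixP=> i j; rewrite !mxE.
set x := enum_val i; set y := enum_val j.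
have -> : \sum_l A i l * A l j = #|neighbors e x :&: neighbors e y|%:R.
  transitivity (\sum_(z : T) ((e x z && e y z)%:R : R)).
    rewrite (reindex (@enum_val T T)) /=; last exact/onW_bij/enum_val_bij.
    by apply: eq_bigr => l _; rewrite !mxE -natrM mulnb (e_sym _ (enum_val j)).
  rewrite -natr_sum -big_mkcond /= sum1_card; congr _%:R.
  by apply: eq_card => z; rewrite !inE.
have [eq_ij|neq_ij] := eqVneq i j.
  by rewrite /y -eq_ij setIid deg e_irr !(mulr1, mulr0, mulr1n); ring.
have neq_xy : x != y by rewrite (inj_eq enum_val_inj).
case: (boolP (e x y)) => [exy|nexy].
  by rewrite (common_adj exy) mulr0n /=; ring.
by rewrite (common_nadj neq_xy nexy) mulr0n /=; ring.
Qed.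

Lemma adjacency_mulJ : A *m J = k%:R *: J.
Proof.
apply/matrixP=> i j; rewrite !mxE mulr1 -(deg (enum_val i)).
transitivity (\sum_(z : T) ((e (enum_val i) z)%:R : R)).
  rewrite (reindex (@enum_val T T)) /=; last exact/onW_bij/enum_val_bij.
  by apply: eq_bigr => l _; rewrite !mxE mulr1.
rewrite -natr_sum -big_mkcond /= sum1_card; congr _%:R.
by apply: eq_card => z; rewrite !inE.
Qed.

Lemma adjacency_tr : A^T = A.
Proof. by apply/matrixP=> i j; rewrite !mxE e_sym. Qed.

Lemma mulJ_adjacency : J *m A = k%:R *: J.
Proof.
apply: trmx_inj; rewrite trmx_mul adjacency_tr linearZ /= trmx_const.
exact: adjacency_mulJ.
Qed.

Lemma allones_sqr : J *m J = v%:R *: J.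
Proof.
apply/matrixP=> i j; rewrite !mxE mulr1.
rewrite (eq_bigr (fun=> 1)) => [|l _]; last by rewrite !mxE mulr1.
by rewrite sumr_const card_ord cardT.
Qed.

(** The quadratic whose roots are the eigenvalues of [A] other than k. *)
Let p (x : R) := x ^+ 2 - (lambda%:R - mu%:R) * x - (k%:R - mu%:R).

(** This is k(k - lambda - 1) = (v - k - 1) mu in disguise, read off a diagonal entry of AAJ. *)
Lemma srg_count : p k%:R = mu%:R * v%:R.
Proof.
have [x _] := exists_induced_path2; pose i := enum_rank x.
have /(congr1 (fun M : 'M[R]_#|T| => M i i)) : A *m A *m J = A *m (A *m J).
  by rewrite mulmxA.
rewrite adjacency_sqr !mulmxDl -!scalemxAl !adjacency_mulJ -scalemxAr.
rewrite adjacency_mulJ allones_sqr mul_scalar_mx !mxE !mulr1 /p => h.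
lra.
Qed.

(** An eigenvector for a value other than k is killed by [J], so the formula for [A *m A] acts on it
    as a quadratic relation in [a]. *)
Lemma eigenvalue_root a : eigenvalue A a -> a != k%:R -> p a = 0.
Proof.
case/eigenvalueP=> u uA u0 neq_ak.
have uJ : u *m J = 0.
  have /eqP : (u *m A) *m J = u *m (A *m J) by rewrite mulmxA.
  rewrite uA adjacency_mulJ -scalemxAl -scalemxAr -subr_eq0 -scalerBl.
  by rewrite scaler_eq0 subr_eq0 (negPf neq_ak) => /eqP.
have /eqP : (u *m A) *m A = u *m (A *m A) by rewrite mulmxA.
rewrite uA -scalemxAl uA adjacency_sqr !mulmxDr -!scalemxAr uJ uA scaler0 addr0.
rewrite mul_mx_scalar !scalerA -scalerDl -subr_eq0 -scalerBl scaler_eq0.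
by rewrite (negPf u0) orbF => /eqP <-; rewrite /p; ring.
Qed.

(* If [r] is the other root of [p], the rows of [(A - k)(A - r)] are
   eigenvectors for [s]; this matrix is nonzero since it has the entry [mu] at any two
   nonadjacent vertices. *)
Lemma root_eigenvalue s : p s = 0 -> eigenvalue A s.
Proof.
move=> ps0; pose r := lambda%:R - mu%:R - s.
pose B := A *m A - (k%:R + r) *: A + (k%:R * r)%:M.
have BA : B *m A = s *: B.
  have defB : B = (k%:R - mu%:R + k%:R * r)%:M
                   + (lambda%:R - mu%:R - k%:R - r) *: A + mu%:R *: J.
    by rewrite /B adjacency_sqr; apply/matrixP=> i j; rewrite !mxE;
       case: (i == j); rewrite ?mulr0n ?mulr1n; ring.
  rewrite defB !mulmxDl -!scalemxAl mulJ_adjacency adjacency_sqr mul_scalar_mx.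
  have ks : k%:R - mu%:R = s ^+ 2 - (lambda%:R - mu%:R) * s.
    by apply/eqP; rewrite eq_sym -subr_eq0; apply/eqP.
  rewrite ks; apply/matrixP=> i j; rewrite !mxE /r.
  by case: (i == j); rewrite ?mulr0n ?mulr1n; ring.
have [x [y [z [_ _ neq_xz nexz]]]] := exists_induced_path2.
pose i := enum_rank x; pose j := enum_rank z.
have Bij : B i j = mu%:R.
  rewrite /B adjacency_sqr !mxE !enum_rankK (negPf nexz).
  by rewrite (inj_eq enum_rank_inj) (negPf neq_xz) !mulr0n; ring.
apply/eigenvalueP; exists (row i B); first by rewrite -row_mul BA linearZ.
apply/eqP=> /rowP/(_ j)/eqP; rewrite mxE Bij mxE pnatr_eq0.
by rewrite eqn0Ngt srg_mu_gt0.
Qed.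

(** As p(-1) = lambda + 1 - k < 0, the smaller root of [p] is below -1. It is an eigenvalue, so [a]
    is below -1 too and differs from k. *)
Lemma srg_smallest_root_lt a : smallest_eigenvalue e a -> a < -1 /\ p a = 0.
Proof.
case=> eig_a min_a.
have kge : (lambda%:R + 2 : R) <= k%:R.
  by rewrite -natrD ler_nat addn2 srg_lambda_lt.
have lambda_ge0 : (0 : R) <= lambda%:R by [].
have muk : (mu%:R : R) <= k%:R by rewrite ler_nat srg_mu_le_valency.
pose b : R := lambda%:R - mu%:R.
(* The square root of the discriminant of [p]; its smaller root is [(b - d) / 2]. *)
pose d := Num.sqrt (b ^+ 2 + 4 * (k%:R - mu%:R)).
have d0 : 0 <= d := sqrtr_ge0 _.
have d2 : d ^+ 2 = b ^+ 2 + 4 * (k%:R - mu%:R).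
  by rewrite sqr_sqrtr // addr_ge0 ?sqr_ge0 // mulr_ge0 // subr_ge0.
have lt_d : b + 2 < d.
  rewrite ltNge; apply/negP=> led.
  have : d * d <= (b + 2) * (b + 2) by rewrite ler_pM.
  by move: d2; rewrite /b !expr2; nra.
have a_le : a <= (b - d) / 2.
  apply/min_a/root_eigenvalue; rewrite /p -/b.
  have -> : k%:R - mu%:R = (d ^+ 2 - b ^+ 2) / 4 by rewrite d2; field.
  by field.
have a_lt : a < -1 by lra.
split=> //; apply: (eigenvalue_root eig_a).
by rewrite lt_eqF //; lra.
Qed.

(** * The rank bound for cliques *)

Lemma srg_clique_le m (C : {set T}) :
    1 < m -> p (- m) = 0 -> clique e C ->
  (lambda%:R - mu%:R + 2 * m) * (#|C|%:R - 1) <= v%:R * m - k%:R - m.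
Proof.
move=> m_gt1 pm0 cliqueC.
have muR : 0 < mu%:R :> R by rewrite ltr0n srg_mu_gt0.
have kmu : k%:R - mu%:R = m ^+ 2 + (lambda%:R - mu%:R) * m.
  by apply/eqP; rewrite eq_sym -subr_eq0 -pm0 /p; apply/eqP; ring.
have kmu0 : 0 <= k%:R - mu%:R :> R.
  by rewrite subr_ge0 ler_nat srg_mu_le_valency.
(* The roots of [p] sum to lambda - mu, so r = lambda - mu + m and [rho] is r + m. Since rm = k - mu
   is nonnegative, so is r, whence [rho] is positive. *)
set rho := lambda%:R - mu%:R + 2 * m.
have rho_gt0 : 0 < rho by rewrite /rho; nra.
have [x _] := exists_induced_path2.
have v_gt0 : 0 < v%:R :> R by rewrite ltr0n -cardT; apply/card_gt0P; exists x.
have v_neq0 : v%:R != 0 :> R by rewrite gt_eqF.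
(* The coefficient for which JE = 0. *)
pose w := (k%:R + m) / v%:R.
pose E : 'M[R]_#|T| := A + m%:M - w *: J.
have EE : E *m E = rho *: E.
  rewrite /E !mulmxDl !mulmxDr !mulmxN !mulNmx -!scalemxAl -!scalemxAr.
  rewrite allones_sqr mulJ_adjacency adjacency_mulJ adjacency_sqr.
  rewrite !mul_scalar_mx !mul_mx_scalar.
  (* [srg_count] with p(k) factored as (k + m)(k - r). *)
  have kv : mu%:R = (k%:R + m) * (k%:R - (lambda%:R - mu%:R + m)) / v%:R.
    apply: (mulIf v_neq0); rewrite mulfVK // -srg_count /p kmu; ring.
  apply/matrixP=> i j; rewrite !mxE kmu.
  rewrite [in mu%:R * 1]kv /w /rho.
  by case: (i == j); rewrite ?mulr0n ?mulr1n; field.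
have trE : \tr E = v%:R * m - k%:R - m.
  have tr_m : \tr (m%:M : 'M[R]_#|T|) = m *+ v by rewrite mxtrace_scalar cardT.
  rewrite /E linearB linearD linearZ /= tr_m.
  have -> : \tr A = 0.
    by rewrite /mxtrace big1 // => i _; rewrite mxE e_irr.
  have -> : \tr J = v%:R.
    rewrite /mxtrace (eq_bigr (fun=> 1)) => [|i _]; last by rewrite mxE.
    by rewrite sumr_const card_ord cardT.
  by rewrite /w mulfVK // -mulr_natr; ring.
pose f (i : 'I_#|C|) := enum_rank (enum_val i).
have subE : mxsub f f E = (m - 1)%:M + const_mx (1 - w).
  apply/matrixP=> i j; rewrite !mxE !enum_rankK.
  rewrite (inj_eq enum_rank_inj) (inj_eq enum_val_inj).
  have [->|neq_ij] := eqVneq i j; first by rewrite e_irr mulr0n !mulr1n; ring.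
  have -> : e (enum_val i) (enum_val j).
    by apply: cliqueC; rewrite ?enum_valP ?(inj_eq enum_val_inj).
  by rewrite mulr1n !mulr0n; ring.
rewrite -trE (mxtrace_quasi_idempotent EE) ler_pM2l // lerBlDr natr1 ler_nat.
rewrite (leq_trans (@mxrank_scalar_add_const R #|C| (m - 1) (1 - w) _)) //.
  by rewrite subr_eq0 gt_eqF.
by rewrite -subE ltnS mxrank_mxsub.
Qed.

Lemma srg_delsarte_mu_bound (m : R) :
    smallest_eigenvalue e (- m) -> (exists C, delsarte_clique e k m C) ->
  mu%:R * (k%:R + m ^+ 2 - mu%:R) <= m ^+ 2 * (m - 1) * (k%:R + m).
Proof.
case/srg_smallest_root_lt=> m_lt pm0 [C [cliqueC cardC]].
have m_gt1 : 1 < m by lra.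
have muR : 0 < mu%:R :> R by rewrite ltr0n srg_mu_gt0.
have kR : 0 < k%:R :> R.
  by rewrite (lt_le_trans muR) // ler_nat srg_mu_le_valency.
have := srg_clique_le m_gt1 pm0 cliqueC.
rewrite cardC [1 + _]addrC addrK => le1.
move: srg_count pm0; rewrite /p => count pm0.
have m0 : m != 0 by rewrite gt_eqF //; lra.
have lam : lambda%:R = mu%:R - m + (k%:R - mu%:R) / m.
  by apply: (mulIf m0); rewrite mulrDl mulfVK //; lra.
have hv :
    v%:R = (k%:R ^+ 2 - (lambda%:R - mu%:R) * k%:R - (k%:R - mu%:R)) / mu%:R
      :> R.
  by rewrite count mulrAC mulfV ?mul1r ?gt_eqF.
(* After elimination of lambda and v, k times the gap in the goal equals m^2 mu times the gap in
   [le1]. *)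
rewrite -subr_ge0 -(pmulr_rge0 _ kR).
have c0 : 0 <= m ^+ 2 * mu%:R by rewrite mulr_ge0 ?sqr_ge0 ?ltW.
have := mulr_ge0 c0 (etrans (subr_ge0 _ _) le1).
rewrite hv lam; congr (0 <= _).
by field; rewrite m0 gt_eqF.
Qed.

End StronglyRegular.

(** * Location of mu relative to the roots *)

Theorem proposition3p3 (R : rcfType) (T : finType) (e : rel T)
    (v k lambda mu : nat) (m : R)
    (srg_e : strongly_regular e v k lambda mu)
    (ncomplete_e : ~ complete_graph e)
    (min_eig : smallest_eigenvalue e (- m))
    (k_ge : m ^+ 2 * (4 * m - 5) <= k%:R)
    (has_delsarte : exists C : {set T}, delsarte_clique e k m C) :
  mu%:R <= (k%:R + m ^+ 2
            - Num.sqrt ((k%:R + m ^+ 2)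
                        * (k%:R - 4 * m ^+ 3 + 5 * m ^+ 2))) / 2 \/
  (k%:R + m ^+ 2
   + Num.sqrt ((k%:R + m ^+ 2)
               * (k%:R - 4 * m ^+ 3 + 5 * m ^+ 2))) / 2 <= mu%:R.
Proof.
have [m_lt _] := srg_smallest_root_lt srg_e ncomplete_e min_eig.
have bound := srg_delsarte_mu_bound srg_e ncomplete_e min_eig has_delsarte.
have m_gt1 : 1 < m by lra.
set K := k%:R + m ^+ 2 in bound *.
(* [D] is K(K - 4m^2(m - 1)), the discriminant of x^2 - Kx + m^2(m - 1)K. *)
set D := K * _; set x : R := mu%:R in bound *.
have weaken : x * (K - x) <= m ^+ 2 * (m - 1) * K.
  apply: le_trans bound _; rewrite ler_wpM2l ?lerD2l ?ler_eXnr //; last lra.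
  by rewrite mulr_ge0 ?sqr_ge0 //; lra.
have D_le : D <= (2 * x - K) ^+ 2.
  rewrite -subr_ge0.
  have -> : (2 * x - K) ^+ 2 - D = 4 * (m ^+ 2 * (m - 1) * K - x * (K - x)).
    by rewrite /D /K; ring.
  by rewrite mulr_ge0 // subr_ge0.
(* The sign of [2 * x - K] selects the side on which mu lies. *)
have : Num.sqrt D <= `|2 * x - K| by rewrite -sqrtr_sqr ler_sqrt ?sqr_ge0.
by rewrite ler_normr => /orP[] h; [right|left]; lra.
Qed.
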